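(* Let $k,\ell\ge 2$ be integers. The number of minimal $(k,\ell)$-crucial permutations is $\binom{k+\ell-4}{k-2}$.
   Context: $i_m=12\cdots m$ and $d_m=m(m-1)\cdots 1$; a permutation (in one-line notation) contains $i_m$ (resp. $d_m$) if it has an increasing (resp. decreasing) subsequence of length $m$, and avoids it otherwise. The extensions of a permutation $\sigma=\sigma_1\cdots\sigma_n$ of $\{1,\ldots,n\}$ ($n\ge1$) to the right are the permutations $e_t(\sigma_1)\cdots e_t(\sigma_n)\,t$ of $\{1,\ldots,n+1\}$, $1\le t\le n+1$, where $e_t(x)=x$ if $x<t$ and $e_t(x)=x+1$ if $x\ge t$. A permutation is $(k,\ell)$-crucial (the same as $(k,\ell)$-right-crucial) if it avoids $i_k$ and $d_\ell$ but each of its extensions to the right contains $i_k$ or $d_\ell$. A $(k,\ell)$-crucial permutation is minimal if there is no $(k,\ell)$-crucial permutation (same $k,\ell$) of smaller length. *)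

(* Defs.v *)
From mathcomp Require Import all_boot all_fingroup.

Set Implicit Arguments.
Unset Strict Implicit.
Unset Printing Implicit Defensive.

(* A permutation of {1, ..., n} is an element s of 'S_n, with positions and   *)
(* values shifted to {0, ..., n-1}: its one-line notation is s 0 ... s (n-1). *)

(* A subsequence is given by its set of positions. *)
Definition contains_inc (m n : nat) (s : 'S_n) : bool :=
  [exists A : {set 'I_n}, (#|A| == m) &&
    [forall i in A, forall j in A, (i < j) ==> (s i < s j)]].

Definition contains_dec (m n : nat) (s : 'S_n) : bool :=
  [exists A : {set 'I_n}, (#|A| == m) &&
    [forall i in A, forall j in A, (i < j) ==> (s j < s i)]].

(* lift_perm ord_max t s sends the last position to t, and the i-th position, *)
(* i < n, to bump t (s i), which is s i if s i < t and (s i).+1 otherwise.    *)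
Definition right_extension (n : nat) (s : 'S_n) (t : 'I_n.+1) : 'S_n.+1 :=
  lift_perm ord_max t s.

Definition crucial (k l n : nat) (s : 'S_n) : bool :=
  [&& 0 < n, ~~ contains_inc k s, ~~ contains_dec l s &
    [forall t : 'I_n.+1, contains_inc k (right_extension s t)
                      || contains_dec l (right_extension s t)]].

Notation permutation := {n : nat & 'S_n}.

Definition minimal_crucial (k l : nat) (p : permutation) : Prop :=
  crucial k l (tagged p) /\
  ~ exists q : permutation, crucial k l (tagged q) /\ tag q < tag p.

Definition has_cardinal (T : eqType) (P : T -> Prop) (c : nat) : Prop :=
  exists2 e : seq T, uniq e /\ (forall x : T, x \in e <-> P x) & size e = c.

(* Main.v *)
Require Import Defs.
From mathcomp Require Import all_boot all_fingroup.
From mathcomp Require Import zify.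

(** If [s] avoids both patterns, its extension by [t] contains an increasing
    [k]-chain exactly when [s] has an increasing [(k-1)]-chain with all values
    below [t], and a decreasing [l]-chain exactly when it has a decreasing
    [(l-1)]-chain with all values at least [t].  If every [t] does one or the
    other, take the smallest [t] of the first kind: [t] gives an increasing
    chain [A] and [t - 1] a decreasing chain [B], such that the last value of
    [A] is at most the last value of [B].  Unless the two last entries coincide,
    the later of them prolongs the other chain to a forbidden pattern.  Hence
    [s] is crucial exactly when it avoids both patterns and some entry ends both
    an increasing [(k-1)]-chain and a decreasing [(l-1)]-chain (lemma
    [crucialP]).

    Two such chains share only their last entry, so a crucial permutation has at
    least [k + l - 3] entries.  Write [k = K + 2] and [l = L + 2].  When the
    length is [K + L + 1], the chains cover everything: the common entry is the
    last one, it has value [K], the smaller values appear in increasing order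
    and the larger ones in decreasing order.  Conversely every such permutation
    is crucial, because an increasing sequence contains at most one entry of a
    decreasing one (lemma [crucial_shuffle]).  These permutations are determined
    by the set of positions of the [K] smallest values, which can be any
    [K]-subset of the [K + L] positions other than the last ([low_inj],
    [shuffle_exists]); there are ['C(K + L, K)] of them, and since there is at
    least one, they are all the minimal crucial permutations. *)

Set Implicit Arguments.
Unset Strict Implicit.
Unset Printing Implicit Defensive.

(** * Monotone sets of positions *)

(** The relation [r] on values is [ltn] or [gtn], so that increasing and
    decreasing patterns share their lemmas; for these two relations [contains]
    is convertible to [contains_inc] and [contains_dec]. *)
Definition monotone (r : rel nat) (n : nat) (s : 'S_n) (A : {set 'I_n}) : bool :=
  [forall i in A, forall j in A, (i < j) ==> r (s i) (s j)].

Definition contains (r : rel nat) (m n : nat) (s : 'S_n) : bool :=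
  [exists A : {set 'I_n}, (#|A| == m) && monotone r s A].

Lemma monotoneP (r : rel nat) (n : nat) (s : 'S_n) (A : {set 'I_n}) :
  reflect (forall i j : 'I_n, i \in A -> j \in A -> i < j -> r (s i) (s j))
          (monotone r s A).
Proof.
apply: (iffP forall_inP) => [H i j iA jA ij | H i iA].
  by have /forall_inP/(_ j jA)/implyP := H i iA; apply.
by apply/forall_inP => j jA; apply/implyP => ij; apply: H.
Qed.

Lemma containsP (r : rel nat) (m n : nat) (s : 'S_n) :
  reflect (exists2 A : {set 'I_n}, #|A| = m & monotone r s A) (contains r m s).
Proof.
apply: (iffP existsP) => [[A /andP[/eqP cA mA]] | [A cA mA]]; exists A => //.
by rewrite cA eqxx.
Qed.

Lemma monotone_setU1 (r : rel nat) (n : nat) (s : 'S_n) (A : {set 'I_n})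
    (x : 'I_n) :
  monotone r s A -> (forall i, i \in A -> (i < x) && r (s i) (s x)) ->
  monotone r s (x |: A).
Proof.
move=> /monotoneP mA Ax; apply/monotoneP => i j.
move=> /setU1P[-> | iA] /setU1P[-> | jA]; rewrite ?ltnn //.
- by have /andP[jx _] := Ax _ jA; lia.
- by have /andP[_ ->] := Ax _ iA.
- exact: mA.
Qed.

Lemma card_inc_dec n (s : 'S_n) (A B : {set 'I_n}) :
  monotone ltn s A -> monotone gtn s B -> #|A :&: B| <= 1.
Proof.
move=> /monotoneP mA /monotoneP mB; rewrite leqNgt; apply/card_gt1P.
case=> i [j [/setIP[iA iB] /setIP[jA jB]]].
case: (ltngtP i j) => [ij | ji | /val_inj ->]; last by rewrite eqxx.
  by have /= := mA _ _ iA jA ij; have /= := mB _ _ iB jB ij; lia.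
by have /= := mA _ _ jA iA ji; have /= := mB _ _ jB iB ji; lia.
Qed.

(** * Crucial permutations *)

Lemma right_extension_lift n (s : 'S_n) (t : 'I_n.+1) i :
  right_extension s t (lift ord_max i) = lift t (s i).
Proof. exact: lift_perm_lift. Qed.

Lemma right_extension_max n (s : 'S_n) (t : 'I_n.+1) :
  right_extension s t ord_max = t.
Proof. exact: lift_perm_id. Qed.

(** A new occurrence of the pattern must use the new last entry; removing it
    leaves a chain one shorter, all of whose values relate to [t].  The
    hypothesis on [bump t] says that making room for [t] preserves the relation
    between the old values. *)
Lemma contains_right_extension (r : rel nat) m n (s : 'S_n) (t : 'I_n.+1) :
    (forall x y, r (bump t x) (bump t y) = r x y) -> ~~ contains r m.+1 s ->
  reflect (exists A : {set 'I_n}, [/\ #|A| = m, monotone r s A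
                                  & forall i, i \in A -> r (bump t (s i)) t])
          (contains r m.+1 (right_extension s t)).
Proof.
move=> rt avoid_s; apply: (iffP (containsP _ _ _)) => [[A cA /monotoneP mA] | ].
  pose B : {set 'I_n} := [set i | lift ord_max i \in A].
  have mB : monotone r s B.
    apply/monotoneP => i j; rewrite !inE => iA jA ij.
    have := mA _ _ iA jA; rewrite !right_extension_lift !lift_max rt; exact.
  have cB : #|A :\ ord_max| = #|B|.
    rewrite -(card_imset B (@lift_inj n.+1 ord_max)); apply: eq_card => h.
    apply/setD1P/imsetP => [[hN hA] | [i]]; last first.
      by rewrite inE => iA ->; rewrite eq_sym neq_lift.
    case: (unliftP ord_max h) hN hA => [i -> _ iA | ->]; last by rewrite eqxx.
    by exists i; rewrite ?inE.
  have := cardsD1 ord_max A; rewrite cA cB.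
  have [xA [cB'] | xA cB'] := boolP (ord_max \in A); last first.
    by case/negP: avoid_s; apply/containsP; exists B; rewrite // -cB'.
  exists B; split=> // i; rewrite inE => iA.
  have := mA _ _ iA xA; rewrite right_extension_lift right_extension_max; apply.
  by rewrite lift_max.
case=> A [cA /monotoneP mA At]; exists (ord_max |: lift ord_max @: A).
  rewrite cardsU1 (card_imset _ (@lift_inj _ ord_max)) cA.
  by case: imsetP => // -[i _ /eqP]; rewrite (negPf (neq_lift _ _)).
apply: monotone_setU1.
  apply/monotoneP => _ _ /imsetP[i iA ->] /imsetP[j jA ->].
  rewrite !right_extension_lift !lift_max rt => ij; exact: mA.
move=> _ /imsetP[i iA ->].
by rewrite right_extension_lift right_extension_max lift_max ltn_ord At.
Qed.

Lemma max_position n (A : {set 'I_n}) :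
  0 < #|A| -> exists2 x, x \in A & forall i : 'I_n, i \in A -> i <= x.
Proof.
case/card_gt0P => x0 x0A.
by case: (arg_maxnP (fun i : 'I_n => i : nat) x0A) => x xA xmax; exists x.
Qed.

(** A chain of length [m] whose last position is [x]. *)
Definition ends (r : rel nat) (m n : nat) (s : 'S_n) (x : 'I_n) (A : {set 'I_n}) :=
  [/\ #|A| = m, monotone r s A, x \in A & forall i : 'I_n, i \in A -> i <= x].

Lemma ends_rel (r : rel nat) m n (s : 'S_n) x (A : {set 'I_n}) i :
  ends r m s x A -> i \in A -> i != x -> r (s i) (s x).
Proof.
case=> _ /monotoneP mA xA xmax iA inx; apply: mA => //.
by rewrite ltn_neqAle inx xmax.
Qed.

(** The values [t] above that of the common end are blocked by the increasing
    chain, the others by the decreasing chain.  For the existence of a common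
    end, see the overview. *)
Lemma crucialP K L n (s : 'S_n) :
  reflect [/\ ~~ contains ltn K.+2 s, ~~ contains gtn L.+2 s &
            exists x A B, ends ltn K.+1 s x A /\ ends gtn L.+1 s x B]
          (crucial K.+2 L.+2 s).
Proof.
have incE := @contains_right_extension ltn K.+1 n s.
have decE := @contains_right_extension gtn L.+1 n s.
have rinc (t : 'I_n.+1) x y : ltn (bump t x) (bump t y) = ltn x y.
  by rewrite /bump /=; lia.
have rdec (t : 'I_n.+1) x y : gtn (bump t x) (bump t y) = gtn x y.
  by rewrite /bump /=; lia.
apply: (iffP and4P); last first.
  case=> ainc adec [x [A [B [Ax Bx]]]]; split=> //.
    exact: leq_ltn_trans (ltn_ord x).
  apply/forallP => t; apply/orP; have [sxt | tsx] := ltnP (s x) t; [left|right].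
    apply/(incE t (rinc t) ainc); exists A; case: (Ax) => cA mA _ _; split=> //.
    move=> i iA; have [-> | inx] := eqVneq i x; first by rewrite /bump /=; lia.
    by have := ends_rel Ax iA inx; rewrite /bump /=; lia.
  apply/(decE t (rdec t) adec); exists B; case: (Bx) => cB mB _ _; split=> //.
  move=> i iB; have [-> | inx] := eqVneq i x; first by rewrite /bump /=; lia.
  by have := ends_rel Bx iB inx; rewrite /bump /=; lia.
case=> n_gt0 ainc adec /forallP ext; split=> //.
(* [P t]: the extension by [t] completes an increasing chain. *)
pose P t := [exists A : {set 'I_n}, [&& #|A| == K.+1, monotone ltn s A
                                     & [forall i in A, s i < t]]].
have Pext t : t <= n -> ~~ P t -> exists B : {set 'I_n},
    [/\ #|B| = L.+1, monotone gtn s B & forall i, i \in B -> t <= s i].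
  rewrite -ltnS => ltn nPt; pose t' := Ordinal ltn.
  have /orP[/(incE t' (rinc t') ainc)|/(decE t' (rdec t') adec)] := ext t'.
    case=> A [cA mA At]; case/existsP: nPt; exists A; rewrite cA eqxx mA /=.
    by apply/forall_inP => i /At; rewrite /bump /=; lia.
  by case=> B [cB mB Bt]; exists B; split=> // i /Bt; rewrite /bump /=; lia.
(* No value is at least [n], so a decreasing chain cannot block [t = n]. *)
have Pn : P n.
  apply: contraT => /(Pext n (leqnn n))[B [cB _ Bn]].
  have /card_gt0P[i /Bn] : 0 < #|B| by rewrite cB.
  by rewrite leqNgt ltn_ord.
have nP0 : ~~ P 0.
  apply/existsP => -[A /and3P[/eqP cA _ /forall_inP A0]].
  by have /card_gt0P[i /A0] : 0 < #|A| by rewrite cA.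
(* The minimal [t] with [P t] is [a.+1]: [A] has values at most [a], and since
   [P a] fails, the extension by [a] completes a decreasing chain [B], with
   values at least [a]. *)
case: (ex_minnP (ex_intro _ n Pn)) => -[|a] Pa amin; first by rewrite Pa in nP0.
have an : a < n := amin _ Pn.
have nPa : ~~ P a by apply: contraT => /negPn/amin; rewrite ltnn.
have [B [cB mB Ba]] := Pext _ (ltnW an) nPa.
have {Pa} /existsP[A /and3P[/eqP cA mA /forall_inP Aa]] := Pa.
have [|x xA xmax] := @max_position n A; first by rewrite cA.
have [|y yB ymax] := @max_position n B; first by rewrite cB.
have Ax : ends ltn K.+1 s x A by [].
have By : ends gtn L.+1 s y B by [].
have sxy : s x <= s y by have := Aa _ xA; have := Ba _ yB; lia.
have [exy | nxy] := eqVneq x y.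
  by exists x, A, B; split=> //; rewrite exy.
have {}sxy : s x < s y.
  by rewrite ltn_neqAle sxy andbT; apply: contraNneq nxy => /val_inj/perm_inj->.
(* The later of two distinct ends prolongs the chain of the earlier one. *)
case: (ltngtP x y) => [xy | yx | /val_inj e]; last by rewrite e eqxx in nxy.
  case/negP: ainc; apply/(containsP ltn); exists (y |: A).
    rewrite cardsU1 cA; case: (boolP (y \in A)) => // /xmax; lia.
  apply: monotone_setU1 => // i iA; have := xmax _ iA.
  have [-> | inx] := eqVneq i x; first by rewrite /=; lia.
  by have := ends_rel Ax iA inx; rewrite /=; lia.
case/negP: adec; apply/(containsP gtn); exists (x |: B).
  rewrite cardsU1 cB; case: (boolP (x \in B)) => // /ymax; lia.
apply: monotone_setU1 => // i iB; have := ymax _ iB.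
have [-> | iny] := eqVneq i y; first by rewrite /=; lia.
by have := ends_rel By iB iny; rewrite /=; lia.
Qed.

Lemma card_ends K L n (s : 'S_n) x (A B : {set 'I_n}) :
  ends ltn K.+1 s x A -> ends gtn L.+1 s x B -> (K + L).+1 <= #|A :|: B|.
Proof.
case=> cA mA _ _ [cB mB _ _]; have := cardsUI A B.
by have := card_inc_dec mA mB; rewrite cA cB; lia.
Qed.

Lemma crucial_length K L n (s : 'S_n) : crucial K.+2 L.+2 s -> K + L < n.
Proof.
case/crucialP => _ _ [x [A [B [Ax Bx]]]].
by apply: leq_trans (card_ends Ax Bx) _; rewrite -[n in _ <= n]card_ord max_card.
Qed.

(** * Shuffles of an increasing and a decreasing sequence *)

Definition low (K n : nat) (s : 'S_n) : {set 'I_n} := [set i | s i < K].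

Definition shuffle (K n : nat) (s : 'S_n) : bool :=
  monotone ltn s (low K s) && monotone gtn s (~: low K s).

Lemma card_low K n (s : 'S_n) : K <= n -> #|low K s| = K.
Proof.
move=> Kn; rewrite -sum1dep_card.
rewrite -(reindex_inj (@perm_inj _ s) (F := fun=> 1)
                      (P := fun i : 'I_n => i < K)) /=.
by rewrite -(big_ord_widen _ (fun=> 1)) // sum1_card card_ord.
Qed.

(** A value counts the values below it; this recovers a permutation from the
    relative order of its entries. *)
Lemma low_val n (s : 'S_n) (i : 'I_n) : #|low (s i) s| = s i.
Proof. by rewrite card_low // ltnW. Qed.

(** The entries below a low entry are the earlier low ones; the entries above a
    high entry are the earlier high ones.  So the values are a function of the
    set of low positions. *)
Lemma shuffle_valE K n (s : 'S_n.+1) (i : 'I_n.+1) : shuffle K s ->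
  s i = (if i \in low K s then #|[set j in low K s | j < i]|
         else n - #|[set j in ~: low K s | j < i]|) :> nat.
Proof.
case/andP=> /monotoneP minc /monotoneP mdec.
case: ifP => iA.
  rewrite -{1}low_val; apply: eq_card => j; rewrite 2!inE.
  have [jA | jA] /= := boolP (j \in low K s); last first.
    by move: iA jA; rewrite !inE; lia.
  case: (ltngtP j i) => [ji | ij | /val_inj->]; last by rewrite ltnn.
    by have /= := minc _ _ jA iA ji; lia.
  by have /= := minc _ _ iA jA ij; lia.
have -> : [set j in ~: low K s | j < i] = ~: low (s i).+1 s.
  move/negbT: iA; rewrite -in_setC => iA.
  apply/setP => j; rewrite in_set; have [jA | jA] /= := boolP (j \in ~: low K s).
    case: (ltngtP j i) => [ji | ij | /val_inj->]; last by rewrite !inE ltnSn.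
      by have := mdec _ _ jA iA ji; rewrite !inE /=; lia.
    by have := mdec _ _ iA jA ij; rewrite !inE /=; lia.
  by move: iA jA; rewrite !inE; lia.
by rewrite cardsCs setCK card_ord card_low //; have := ltn_ord (s i); lia.
Qed.

Lemma low_inj K n (s s' : 'S_n.+1) :
  shuffle K s -> shuffle K s' -> low K s = low K s' -> s = s'.
Proof.
move=> sh sh' e; apply/permP => i; apply: val_inj => /=.
by rewrite (shuffle_valE i sh) (shuffle_valE i sh') e.
Qed.

Lemma card_below n (B : {set 'I_n}) (i j : 'I_n) : i \in B -> i < j ->
  #|[set h in B | h < i]| < #|[set h in B | h < j]|.
Proof.
move=> iB ij; apply: proper_card; apply/properP; split.
  by apply/subsetP => h; rewrite !inE => /andP[-> hi]; apply: ltn_trans ij.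
by exists i; rewrite !inE iB //= ltnn.
Qed.

Lemma card_below_lt n (B : {set 'I_n}) (i : 'I_n) : i \in B ->
  #|[set h in B | h < i]| < #|B|.
Proof.
move=> iB; apply: proper_card; apply/properP; split.
  by apply/subsetP => h; rewrite !inE => /andP[->].
by exists i; rewrite // !inE iB //= ltnn.
Qed.

(** The values are those forced by [shuffle_valE].  There are [n.+1 - #|A|]
    positions outside [A], so each is preceded by at most [n - #|A|] others, and
    the values there do not go below [#|A|]. *)
Lemma shuffle_exists n (A : {set 'I_n.+1}) :
  exists2 s : 'S_n.+1, shuffle #|A| s & low #|A| s = A.
Proof.
pose below (B : {set 'I_n.+1}) (i : 'I_n.+1) := #|[set h in B | h < i]|.
pose w i := if i \in A then below A i else n - below (~: A) i.
have cA : #|A| + #|~: A| = n.+1 by rewrite cardsC card_ord.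
have w_low i : i \in A -> w i < #|A|.
  by move=> iA; rewrite /w iA; apply: card_below_lt.
have hi_below i : i \notin A -> below (~: A) i < #|~: A|.
  by rewrite -in_setC; apply: card_below_lt.
have w_high i : i \notin A -> #|A| <= w i.
  by move=> iA; have := hi_below _ iA; rewrite /w (negPf iA); lia.
have w_inc i j : i \in A -> j \in A -> i < j -> w i < w j.
  by move=> iA jA ij; rewrite /w iA jA; apply: card_below.
have w_dec i j : i \notin A -> j \notin A -> i < j -> w j < w i.
  move=> iA jA ij; rewrite /w (negPf iA) (negPf jA).
  have : below (~: A) i < below (~: A) j by apply: card_below; rewrite ?inE.
  by have := hi_below _ jA; lia.
have w_lt i : w i < n.+1.
  have [/w_low | iA] := boolP (i \in A); first by lia.
  by rewrite /w (negPf iA); lia.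
have w_inj : injective (fun i => Ordinal (w_lt i)).
  move=> i j /(congr1 val) /= e.
  have [iA | iA] := boolP (i \in A); have [jA | jA] := boolP (j \in A).
  - case: (ltngtP i j) => [ij | ji | /val_inj] //.
      by have := w_inc _ _ iA jA ij; lia.
    by have := w_inc _ _ jA iA ji; lia.
  - by have := w_low _ iA; have := w_high _ jA; lia.
  - by have := w_low _ jA; have := w_high _ iA; lia.
  - case: (ltngtP i j) => [ij | ji | /val_inj] //.
      by have := w_dec _ _ iA jA ij; lia.
    by have := w_dec _ _ jA iA ji; lia.
pose s := perm w_inj.
have sE i : s i = w i :> nat by rewrite permE.
have lowE : low #|A| s = A.
  apply/setP => i; rewrite inE sE; have [/w_low | /w_high] := boolP (i \in A); lia.
exists s => //; apply/andP; rewrite lowE.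
split; apply/monotoneP => i j; rewrite ?inE !sE; [exact: w_inc | exact: w_dec].
Qed.

(** * Crucial permutations of minimal length *)

(** The condition on [ord_max] says that the last entry is not among the [K]
    smallest: it then exceeds all low entries and prolongs their sequence, while
    it also ends the decreasing sequence of high entries.  The positions thus
    split in two ways into an increasing and a decreasing set, of sizes [K] and
    [L.+1], or [K.+1] and [L]. *)
Lemma crucial_shuffle K L (s : 'S_(K + L).+1) :
  crucial K.+2 L.+2 s = shuffle K s && (ord_max \notin low K s).
Proof.
apply/crucialP/andP => [[_ _ [x [A [B [Ax Bx]]]]] | [sh maxN]].
  have AB : A :|: B = setT.
    by apply/eqP; rewrite eqEcard subsetT cardsT card_ord (card_ends Ax Bx).
  have [cA mA xA xmaxA] := Ax; have [cB mB xB xmaxB] := Bx.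
  have lowE : low (s x) s = A :\ x.
    apply/setP => i; rewrite !inE; have [-> | inx] := eqVneq i x.
      by rewrite ltnn.
    have /setUP[iA | iB] : i \in A :|: B by rewrite AB.
      by have /= := ends_rel Ax iA inx; rewrite iA => ->.
    have sxi := ends_rel Bx iB inx.
    have [iA | iA] := boolP (i \in A); first exact: ends_rel Ax iA inx.
    by move: sxi => /=; lia.
  have sx : s x = K :> nat.
    by rewrite -low_val lowE; have := cardsD1 x A; rewrite xA cA => -[].
  rewrite sx in lowE.
  have xE : x = ord_max.
    apply: val_inj; apply/eqP; rewrite eqn_leq leq_ord /=.
    by have /setUP[/xmaxA | /xmaxB] : ord_max \in A :|: B by rewrite AB inE.
  rewrite -xE inE sx ltnn /shuffle lowE; split=> //; apply/andP; split.
    move/monotoneP: mA => mA; apply/monotoneP => i j.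
    by case/setD1P=> _ iA /setD1P[_ jA]; apply: mA.
  move/monotoneP: mB => mB; apply/monotoneP => i j.
  have CB h : h \in ~: (A :\ x) -> h \in B.
    have [-> // | hx] := eqVneq h x; rewrite !inE hx /= => hA.
    by move/setP/(_ h): AB; rewrite !inE (negPf hA).
  by move=> /CB iB /CB jB; apply: mB.
have [/monotoneP minc mdec] := andP sh.
have cA : #|low K s| = K by rewrite card_low // ltnW // ltnS leq_addr.
pose A : {set 'I_(K + L).+1} := ord_max |: low K s.
pose B : {set 'I_(K + L).+1} := ~: low K s.
have cA' : #|A| = K.+1 by rewrite cardsU1 maxN cA.
have cB' : #|B| = L.+1 by rewrite cardsCs setCK card_ord cA; lia.
have mA : monotone ltn s A.
  apply: monotone_setU1; first exact/monotoneP.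
  move=> i iA; have iN : i != ord_max by apply: contraNneq maxN => <-.
  rewrite ltn_neqAle iN leq_ord /=.
  by move: iA maxN; rewrite !inE; lia.
split.
(* At most one entry of an increasing [C] lies in the decreasing set [B], and
   only [K] positions lie outside [B]. *)
- apply/containsP => -[C cC mC].
  have := card_inc_dec mC mdec; have := cardsID B C.
  have : #|C :\: B| <= #|low K s|.
    by apply: subset_leq_card; apply/subsetP => i; rewrite !inE; lia.
  by rewrite -/B; lia.
(* The set [A] includes the last position: outside it only [L] remain. *)
- apply/containsP => -[C cC mC].
  have := card_inc_dec mA mC; have := cardsID A C; rewrite setIC.
  have : #|C :\: A| <= #|~: A|.
    by apply: subset_leq_card; apply/subsetP => i; rewrite !inE => /andP[].
  by have -> : #|~: A| = L by [rewrite cardsCs setCK card_ord cA'; lia]; lia.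
- exists ord_max, A, B; split; split; rewrite // ?inE ?eqxx ?maxN //.
  + by move=> i _; apply: leq_ord.
  + by move: maxN; rewrite inE.
  + by move=> i _; apply: leq_ord.
Qed.

Lemma card_crucial K L :
  #|[set s : 'S_(K + L).+1 | crucial K.+2 L.+2 s]| = 'C(K + L, K).
Proof.
rewrite -(@card_in_imset _ _ (@low K _)); last first.
  move=> s s'; rewrite !inE !crucial_shuffle => /andP[sh _] /andP[sh' _].
  exact: low_inj.
have -> : 'C(K + L, K) = 'C(#|[set~ (ord_max : 'I_(K + L).+1)]|, K).
  by rewrite cardsC1 card_ord.
rewrite -cards_draws; apply: eq_card => A; rewrite inE subsetC sub1set inE.
apply/imsetP/andP => [[s] | [maxN /eqP cA]].
  rewrite inE crucial_shuffle => /andP[_ maxN] ->; split=> //.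
  by rewrite card_low // ltnW // ltnS leq_addr.
have [s] := shuffle_exists A; rewrite cA => sh lowE; exists s => //.
by rewrite inE crucial_shuffle sh lowE.
Qed.

Theorem corollary8 (k l : nat) (hk : 2 <= k) (hl : 2 <= l) :
  has_cardinal (minimal_crucial k l) 'C(k + l - 4, k - 2).
Proof.
case: k hk => [|[|K]] // _; case: l hl => [|[|L]] // _.
have -> : K.+2 + L.+2 - 4 = K + L by lia.
rewrite -[K.+2 - 2]/(K - 0) subn0.
pose C := [set s : 'S_(K + L).+1 | crucial K.+2 L.+2 s].
exists [seq existT (fun n => 'S_n) (K + L).+1 s | s <- enum C]; last first.
  by rewrite size_map -cardE card_crucial.
split.
  rewrite map_inj_uniq ?enum_uniq // => s s' /eqP.
  by rewrite eq_Tagged => /eqP.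
move=> p; split=> [/mapP[s] | [crp minp]].
  rewrite mem_enum inE => crs ->; split=> // -[[n q] /= [/crucial_length]]; lia.
have [s0 s0C] : exists s0, s0 \in C.
  by apply/card_gt0P; rewrite card_crucial bin_gt0 leq_addr.
case: p crp minp => n s /= crs minp.
have nE : n = (K + L).+1.
  apply/eqP; rewrite eqn_leq (crucial_length crs) andbT leqNgt.
  apply/negP => lt_n.
  apply: minp; exists (existT (fun n => 'S_n) (K + L).+1 s0).
  by rewrite inE in s0C.
by subst n; apply: map_f; rewrite mem_enum inE.
Qed.
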